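(* Let $\mathcal{H}$ be a reproducing kernel Hilbert space on a non-empty set $\Omega$ and let $T\in B(\mathcal{H})$. If $T^2=0$, then for $p\ge2$, $$\mathrm{ber}^p(T)\le\frac1{2^{1+\frac p2}}\,\mathrm{ber}\left(|T|^p+|T^*|^p\right).$$
   Context: A reproducing kernel Hilbert space on $\Omega$ is a Hilbert space of complex-valued functions on $\Omega$ whose point evaluations are bounded; $k_\lambda$ is the reproducing kernel at $\lambda\in\Omega$ (assumed nonzero) and $\hat k_\lambda=k_\lambda/\|k_\lambda\|$. $B(\mathcal{H})$ is the algebra of bounded linear operators on $\mathcal{H}$. $\mathrm{ber}(T)=\sup_{\lambda\in\Omega}|\langle T\hat k_\lambda,\hat k_\lambda\rangle|$ is the Berezin radius, $\mathrm{ber}^p(T)=(\mathrm{ber}(T))^p$, and $|T|=(T^*T)^{1/2}$. *)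

(* Defs.v *)
From HB Require Import structures.
From mathcomp Require Import all_boot all_order all_algebra.
From mathcomp Require Export complex.
From mathcomp Require Import all_classical all_reals all_analysis.

Set Implicit Arguments.
Unset Strict Implicit.
Unset Printing Implicit Defensive.

Import Order.TTheory GRing.Theory Num.Theory.
Import numFieldNormedType.Exports.

Local Open Scope classical_set_scope.
Local Open Scope ring_scope.
Local Open Scope complex_scope.

(** The norm of a [normedModType R[i]] takes its values in [R[i]] (on the
    nonnegative real axis), as does the modulus of a complex number. *)

Section operators.
Context {R : realType} {V : normedModType R[i]}.

Definition bounded_operator (A : V -> V) :=
  linear A /\ exists M : R, forall x, `|A x| <= M%:C * `|x|.

Definition spectrum (A : V -> V) : set R[i] :=
  [set z | ~ exists S, [/\ bounded_operator S,
     forall x, S (A x - z *: x) = x & forall x, A (S x) - z *: S x = x]].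

Definition poly_op (q : {poly R}) (A : V -> V) (x : V) : V :=
  \sum_(i < size q) (q`_i)%:C *: iter i A x.

(** Continuous functional calculus of a self-adjoint operator [A], whose
    spectrum is real: [f(A)] is the limit in operator norm of [q_n(A)] for real
    polynomials [q_n] converging to [f] uniformly on the spectrum of [A]. *)
Definition is_cfc (A : V -> V) (f : R -> R) (B : V -> V) :=
  bounded_operator B /\
  exists q : nat -> {poly R}, forall e : R, 0 < e -> \forall n \near \oo,
    (forall t : R, spectrum A t%:C -> `|(q n).[t] - f t| <= e) /\
    (forall x, `|poly_op (q n) A x - B x| <= e%:C * `|x|).

Definition cfc (A : V -> V) (f : R -> R) : V -> V := xget (cst 0) (is_cfc A f).

Definition op_powR (A : V -> V) (p : R) : V -> V := cfc A (fun t => t `^ p).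

End operators.

(** The inner product is linear in its first argument. *)
HB.mixin Record NormedModule_isHilbert (R : realType) H
    of CompleteNormedModule R[i] H := {
  inner : {dot H for Num.conj} ;
  innerE : forall x : H, inner x x = `|x| ^+ 2
}.

#[short(type="hilbertType")]
HB.structure Definition Hilbert (R : realType) :=
  {H of NormedModule_isHilbert R H & CompleteNormedModule R[i] H}.

Section hilbert_operators.
Context {R : realType} {H : hilbertType R}.

Definition adjoint (A : H -> H) : H -> H :=
  xget (cst 0) [set B | bounded_operator B /\
                        forall x y, inner (A x) y = inner x (B y)].

Definition op_abs (A : H -> H) : H -> H := cfc (adjoint A \o A) Num.sqrt.

End hilbert_operators.

(** A Hilbert space of functions on [Omega] is presented as a Hilbert space with
    an injective linear map to the space of functions on [Omega]. *)
Record rkhs (R : realType) (Omega : Type) := RKHS {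
  rkhs_space :> hilbertType R ;
  feval : rkhs_space -> Omega -> R[i] ;
  feval_linear : forall (a : R[i]) (f g : rkhs_space) lam,
    feval (a *: f + g) lam = a * feval f lam + feval g lam ;
  feval_inj : injective feval ;
  feval_bounded : forall lam, exists M : R, forall f,
    `|feval f lam| <= M%:C * `|f|
}.

Section berezin.
Context {R : realType} {Omega : Type} (H : rkhs R Omega).

Definition rkernel (lam : Omega) : H :=
  xget 0 [set k | forall f : H, feval f lam = inner f k].

Definition normalized_rkernel (lam : Omega) : H :=
  `|rkernel lam|^-1 *: rkernel lam.

Definition ber (A : H -> H) : R :=
  sup [set complex.Re
             `|inner (A (normalized_rkernel lam)) (normalized_rkernel lam)|
      | lam in [set: Omega]].

End berezin.

(* Main.v *)
(** Write [S] for the adjoint of [T] and [<., .>] for the inner product. Since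
    [T^2 = 0], [T x] and [S x] are orthogonal, so pairing a combination
    [conj c T x + c S x], where [c = <T x, x>], with a unit vector [x] gives
    [4 |c|^2 <= |T x|^2 + |S x|^2 =: 2 m]. The tangent line of [u |-> u^(p/2)]
    at [m] minorises [|T|^p] by an affine function of [|T|^2], and likewise for
    [S]; adding the two gives [2 m^(p/2) <= <(|T|^p + |S|^p) x, x>], hence
    [|c|^p <= (m / 2)^(p/2) <= 2^-(1 + p/2) <(|T|^p + |S|^p) x, x>].

    The functional calculus rests on one fact: a real polynomial [q] that is
    nonnegative on the spectrum of a self-adjoint [A] has [q(A) >= 0]. Indeed,
    if [m] is the infimum of the numerical range of [q(A)], then [q(A) - m] is
    not bounded below; factoring [q - m] over the complex numbers, some [A - w]
    with [q(w) = m] is not bounded below, so [w] is real and in the spectrum. *)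
Require Import Defs.
From mathcomp Require Import all_boot all_order all_algebra.
From mathcomp Require Import all_classical all_reals all_analysis.
From mathcomp Require Import ring lra.

Set Implicit Arguments.
Unset Strict Implicit.
Unset Printing Implicit Defensive.

Import Order.TTheory GRing.Theory Num.Theory.
Import numFieldNormedType.Exports.

Local Open Scope classical_set_scope.
Local Open Scope ring_scope.
Local Open Scope complex_scope.

(** * Real structure of a complex Hilbert space *)

Section real_structure.
Context {R : realType} {H : hilbertType R}.
Implicit Types x y z : H.

(** The norm and inner product of [H] are valued in [R[i]]; real parts move every estimate into the
    ordered field [R] and make [H] a real inner product space. *)
Definition rip x y : R := complex.Re (inner x y).
Definition nrm x : R := complex.Re `|x|.

Lemma nrmE x : `|x| = (nrm x)%:C.
Proof. by rewrite /nrm RRe_real // normr_real. Qed.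

Lemma nrm_ge0 x : 0 <= nrm x.
Proof. by rewrite -lecR -nrmE normr_ge0. Qed.

Lemma nrm0 : nrm 0 = 0.
Proof. by rewrite /nrm normr0. Qed.

Lemma nrm_eq0 x : (nrm x == 0) = (x == 0).
Proof. by rewrite -(normr_eq0 x) nrmE (inj_eq (@complexI R)). Qed.

Lemma nrmD x y : nrm (x + y) <= nrm x + nrm y.
Proof. by rewrite -lecR rmorphD /= -!nrmE ler_normD. Qed.

Lemma nrmN x : nrm (- x) = nrm x.
Proof. by rewrite /nrm normrN. Qed.

Lemma nrmBC x y : nrm (x - y) = nrm (y - x).
Proof. by rewrite /nrm distrC. Qed.

Lemma nrmB x y : nrm (x - y) <= nrm x + nrm y.
Proof. by rewrite -(nrmN y) nrmD. Qed.

Lemma nrmZ (a : R[i]) x : nrm (a *: x) = complex.Re `|a| * nrm x.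
Proof.
apply: (@complexI R).
rewrite -nrmE normrZ nrmE -[in LHS](RRe_real (normr_real a)) -rmorphM.
by [].
Qed.

Lemma nrmZr (t : R) x : nrm (t%:C *: x) = `|t| * nrm x.
Proof. by rewrite nrmZ normc_def /= expr0n addr0 sqrtr_sqr. Qed.

Lemma nrmZi x : nrm ('i *: x) = nrm x.
Proof. by rewrite nrmZ normc_def /= expr0n expr1n add0r sqrtr1 mul1r. Qed.

Lemma innerC x y : inner x y = (inner y x)^*.
Proof. by rewrite hermC expr0 mul1r. Qed.

Lemma innerDl x y z : inner (x + y) z = inner x z + inner y z.
Proof. exact: linearDl. Qed.

Lemma innerZl (a : R[i]) x y : inner (a *: x) y = a * inner x y.
Proof. exact: linearZl_LR. Qed.

Lemma innerZr (a : R[i]) x y : inner x (a *: y) = a^* * inner x y.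
Proof. by rewrite innerC innerZl rmorphM /= -innerC. Qed.

Lemma innerDr x y z : inner x (y + z) = inner x y + inner x z.
Proof. by rewrite innerC innerDl rmorphD /= -!innerC. Qed.

Lemma ripC x y : rip x y = rip y x.
Proof. by rewrite /rip innerC; case: (inner y x). Qed.

Lemma ripDl x y z : rip (x + y) z = rip x z + rip y z.
Proof. by rewrite /rip innerDl raddfD. Qed.

Lemma ripDr x y z : rip x (y + z) = rip x y + rip x z.
Proof. by rewrite ripC ripDl !(ripC x). Qed.

Lemma ripZl (t : R) x y : rip (t%:C *: x) y = t * rip x y.
Proof. by rewrite /rip innerZl; case: (inner x y) => a b /=;
  rewrite mul0r subr0. Qed.

Lemma ripZr (t : R) x y : rip x (t%:C *: y) = t * rip x y.
Proof. by rewrite ripC ripZl ripC. Qed.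

Lemma ripNl x y : rip (- x) y = - rip x y.
Proof. by rewrite -scaleN1r -(rmorphN1 (real_complex R)) ripZl mulN1r. Qed.

Lemma ripNr x y : rip x (- y) = - rip x y.
Proof. by rewrite ripC ripNl ripC. Qed.

Lemma ripBl x y z : rip (x - y) z = rip x z - rip y z.
Proof. by rewrite ripDl ripNl. Qed.

Lemma ripBr x y z : rip x (y - z) = rip x y - rip x z.
Proof. by rewrite ripDr ripNr. Qed.

Lemma rip0l x : rip 0 x = 0.
Proof. by rewrite -(subrr 0) ripBl subrr. Qed.

Lemma ripxx x : rip x x = nrm x ^+ 2.
Proof. by rewrite /rip innerE nrmE -rmorphXn. Qed.

Lemma innerxx x : inner x x = (nrm x ^+ 2)%:C.
Proof. by rewrite innerE nrmE -rmorphXn. Qed.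

(** Since [Re <i x, y> = - Im <x, y>], the real inner product determines the complex one. *)
Lemma inner_rip x y : inner x y = Complex (rip x y) (- rip ('i *: x) y).
Proof.
rewrite /rip innerZl; case: (inner x y) => a b /=.
by rewrite mul0r mul1r sub0r opprK.
Qed.

Lemma rip_CS x y : `|rip x y| <= nrm x * nrm y.
Proof.
have [->|y0] := eqVneq y 0;
  first by rewrite ripC rip0l normr0 mulr_ge0 ?nrm_ge0.
have ny : 0 < nrm y by rewrite lt_def nrm_eq0 y0 nrm_ge0.
(* This [t] minimises [nrm (x - t y)]. *)
pose t := rip x y / nrm y ^+ 2.
have := sqr_ge0 (nrm (x - t%:C *: y)).
rewrite -ripxx ripBl !ripBr !ripZl !ripZr !ripxx (ripC y x) => h.
have e : t * nrm y ^+ 2 = rip x y by rewrite /t divfK // expf_neq0 // gt_eqF.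
have h2 : rip x y ^+ 2 <= (nrm x * nrm y) ^+ 2.
  have : 0 <= nrm x ^+ 2 - t * rip x y.
    by move: h; rewrite e; lra.
  rewrite -(pmulr_lge0 _ (exprn_gt0 2 ny)).
  by rewrite exprMn; move: e; move: (t) => s e; rewrite -e; nra.
by rewrite -ler_sqr ?nnegrE ?mulr_ge0 ?nrm_ge0 ?normr_ge0 // real_normK
  ?num_real.
Qed.

Lemma rip_CSW x y : rip x y <= nrm x * nrm y.
Proof. exact: le_trans (ler_norm _) (rip_CS _ _). Qed.

(** Completeness of [H], freed of filters and of norms valued in [R[i]]. *)
Lemma nrm_cvg (u : nat -> H) :
  (forall e, 0 < e -> exists N, forall m n, (N <= m)%N -> (N <= n)%N ->
     nrm (u m - u n) <= e) ->
  exists l, forall e, 0 < e -> exists N, forall n, (N <= n)%N ->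
    nrm (u n - l) <= e.
Proof.
move=> uC.
have : cvg (u @ \oo).
  apply: cauchy_cvg; apply/cauchy_ballP => eps eps0.
  have e0 : 0 < complex.Re eps / 2.
    by move: eps0; rewrite ltcE => /andP[_ /= h]; rewrite divr_gt0.
  have epsE : eps = (complex.Re eps)%:C by rewrite RRe_real // gtr0_real.
  have [N hN] := uC _ e0.
  exists ([set u n | n in [set n | (N <= n)%N]],
    [set u n | n in [set n | (N <= n)%N]]).
    by split=> /=; exists N => // n /= Nn; exists n.
  move=> [_ _] /= [[m Nm <-] [n Nn <-]].
  rewrite -ball_normE /ball_ /= nrmE epsE ltcR.
  by rewrite (le_lt_trans (hN _ _ Nm Nn)) //; lra.
move=> /cvg_ex[l /cvgrPdist_le ul]; exists l => e e0.
have e0' : 0 < e%:C by rewrite ltcR.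
have [N _ hN] := ul _ e0'.
by exists N => n Nn; rewrite nrmBC -lecR -nrmE; exact: hN.
Qed.

End real_structure.

(** * Coercive operators and adjoints *)

(** Let [e] tend to 0. Having [e <= 1] at hand lets a caller bound [e ^+ 2] by [e]. *)
Lemma le0_of_le_mul {R : realType} (a C : R) :
  (forall e, 0 < e <= 1 -> a <= e * C) -> a <= 0.
Proof.
move=> h; rewrite leNgt; apply/negP => a0.
have C1 : 0 < `|C| + 1 by rewrite ltr_wpDl.
have [s s0 aE] : exists2 s, 0 < s & a = s * (`|C| + 1).
  by exists (a / (`|C| + 1)); rewrite ?divr_gt0 // divfK // gt_eqF.
have [s1|s1] := leP s 1; last first.
  have := h 1; rewrite ltr01 lexx => /(_ isT); rewrite aE mul1r.
  have := ler_norm C; have := normr_ge0 C; nra.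
have := h (s / 2); rewrite divr_gt0 //= => h1.
have {}h1 : a <= s / 2 * C by apply: h1; lra.
by rewrite aE in h1; have := ler_norm C; have := normr_ge0 C; nra.
Qed.

Lemma inv_small {R : realType} (e : R) : 0 < e ->
  exists N, forall n, (N <= n)%N -> n.+1%:R^-1 <= e.
Proof.
move=> e0; have [N _ h] := near_infty_natSinv_lt (PosNum e0).
by exists N => n Nn; apply: ltW; exact: h.
Qed.

Section linear_operators.
Context {R : realType} {H : hilbertType R}.
Implicit Types (x y z : H) (A B : H -> H).

Lemma lin0 A : linear A -> A 0 = 0.
Proof.
by move=> l; have := l (-1) 0 0; rewrite scaler0 addr0 scaleN1r addNr.
Qed.

Lemma linZ A a x : linear A -> A (a *: x) = a *: A x.
Proof. by move=> l; rewrite -(addr0 (a *: x)) l lin0 // addr0. Qed.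

Lemma linD A x y : linear A -> A (x + y) = A x + A y.
Proof. by move=> l; rewrite -(scale1r x) l !scale1r. Qed.

Lemma linN A x : linear A -> A (- x) = - A x.
Proof. by move=> l; rewrite -scaleN1r linZ // scaleN1r. Qed.

Lemma linB A x y : linear A -> A (x - y) = A x - A y.
Proof. by move=> l; rewrite linD // linN. Qed.

Lemma bounded_operator_nrm A : bounded_operator A ->
  exists2 K, 0 < K & forall x, nrm (A x) <= K * nrm x.
Proof.
move=> [_ [M hM]]; exists (`|M| + 1) => [|x]; first by rewrite ltr_wpDl.
have := hM x; rewrite !nrmE -rmorphM lecR => /le_trans; apply.
by rewrite ler_wpM2r ?nrm_ge0 // ler_wpDr // ler_norm.
Qed.

Lemma nrm_bounded_operator A K : linear A ->
  (forall x, nrm (A x) <= K * nrm x) -> bounded_operator A.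
Proof.
by move=> l h; split=> //; exists K => x; rewrite !nrmE -rmorphM lecR.
Qed.

Lemma linear_sub_scale A (a : R[i]) : linear A -> linear (fun x =>
  A x - a *: x).
Proof.
move=> l b x y; rewrite l !scalerDr !scalerA opprD addrACA scalerN scalerA.
by rewrite mulrC.
Qed.

Lemma rip_ir x y : rip x ('i *: y) = - rip ('i *: x) y.
Proof.
rewrite /rip innerZl innerZr; case: (inner x y) => a b /=.
by rewrite !mul0r mulN1r mul1r; ring.
Qed.

Lemma rip_eq x y : (forall h, rip x h = rip y h) -> x = y.
Proof.
move=> h; apply/eqP; rewrite -subr_eq0 -nrm_eq0 -sqrf_eq0 -ripxx ripBl h.
by rewrite subrr.
Qed.

(** For complex-linear [A] this is ordinary self-adjointness: [A] commutes with ['i], so [inner_rip]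
    recovers the imaginary part. *)
Definition self_adjoint A := forall x y, rip (A x) y = rip x (A y).

(* The real part of [<A x, i x>] is the imaginary part of [<A x, x>]. *)
Lemma self_adjoint_ir A x : linear A -> self_adjoint A ->
  rip (A x) ('i *: x) = 0.
Proof.
move=> l sA; have := rip_ir (A x) x;
  rewrite -(linZ 'i x l) (sA ('i *: x)) (ripC _ (A x)).
lra.
Qed.

(* [z] minimises [h |-> <A h, h> - 2 f h]; approximate minimisers converge. *)
Lemma coercive_solve A (f : H -> R) (K d M : R) :
    linear A -> self_adjoint A -> 0 < K -> (forall x, nrm (A x) <= K * nrm x) ->
    0 < d -> (forall x, d * nrm x ^+ 2 <= rip (A x) x) ->
    (forall x y, f (x + y) = f x + f y) ->
    (forall (t : R) x, f (t%:C *: x) = t * f x) ->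
    (forall x, f x <= M * nrm x) ->
  exists z, forall h, rip (A z) h = f h.
Proof.
move=> l sA K0 AK d0 Ad fD fZ fM.
pose J x := rip (A x) x - 2 * f x.
(* The lower bound comes from completing the square in [nrm x]. *)
have Jlb x : - (M ^+ 2 / d) <= J x.
  have h1 := Ad x; have h2 := fM x.
  have : 0 <= (nrm x * d - M) ^+ 2 / d by rewrite divr_ge0 ?sqr_ge0 // ltW.
  have -> : (nrm x * d - M) ^+ 2 / d = d * nrm x ^+ 2 - 2 * (M * nrm x) + M ^+
    2 / d.
    by field; rewrite gt_eqF.
  by rewrite /J; lra.
pose m := inf (range J).
have infJ : has_inf (range J).
  split; first by exists (J 0), 0.
  by exists (- (M ^+ 2 / d)) => _ [x _ <-].
have Jm x : m <= J x by apply: ge_inf; [case: infJ | exists x].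
have JE x h t : J (x + t%:C *: h) =
   J x + 2 * t * (rip (A x) h - f h) + t ^+ 2 * rip (A h) h.
  rewrite /J linD // linZ // !ripDl !ripDr !ripZl !ripZr fD fZ (sA h x) (ripC
    h).
  by ring.
have Q0 h : 0 <= rip (A h) h.
  by apply: le_trans (Ad h); rewrite mulr_ge0 ?sqr_ge0 // ltW.
have Qgt h : h != 0 -> 0 < rip (A h) h.
  move=> h0; apply: lt_le_trans (Ad h).
  by rewrite mulr_gt0 // exprn_gt0 // lt_def nrm_eq0 h0 nrm_ge0.
have f0 : f 0 = 0 by rewrite -(scale0r 0) -(rmorph0 (real_complex R)) fZ mul0r.
(* Along [h], [J] is a quadratic polynomial with minimum [J x - D^2 / <A h, h>], where
   [D = <A x, h> - f h] is the residual. This minimum is at least [m], so near-minimality of [x]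
   bounds [D]. *)
have approx (e : R) x h : J x <= m + e ->
    (rip (A x) h - f h) ^+ 2 <= e * rip (A h) h.
  move=> Je; have [->|h0] := eqVneq h 0.
    by rewrite ripC rip0l f0 subrr expr0n lin0 // rip0l mulr0.
  have := Jm (x + (- (rip (A x) h - f h) / rip (A h) h)%:C *: h).
  rewrite JE; have := Qgt _ h0; move: (rip (A h) h) (_ - f h) => Q D Qp.
  have -> : J x + 2 * (- D / Q) * D + (- D / Q) ^+ 2 * Q = J x - D ^+ 2 / Q.
    by field; rewrite gt_eqF.
  by move=> h1; rewrite -ler_pdivrMr //; lra.
have /choice[u uP] : forall n : nat, exists x, J x <= m + n.+1%:R^-1.
  move=> n; have n0 : 0 < n.+1%:R^-1 :> R by rewrite invr_gt0.
  have [_ [x _ <-] hx] := inf_adherent n0 infJ.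
  by exists x; exact: ltW.
(* [Q = <A (x - y), x - y>] is the difference of the residuals of [x] and [y] in the direction
   [x - y], each of square at most [e Q]; hence [Q^2 <= 4 e Q]. *)
have close (e : R) x y : 0 < e -> J x <= m + e -> J y <= m + e ->
  d * nrm (x - y) ^+ 2 <= 4 * e.
  move=> e0 hx hy; have := approx _ _ (x - y) hx; have := approx _ _ (x - y) hy.
  have := Ad (x - y); have := Q0 (x - y).
  have -> : rip (A (x - y)) (x - y) = (rip (A x) (x - y) - f (x - y)) -
     (rip (A y) (x - y) - f (x - y)) by rewrite linB // ripBl; ring.
  move: (rip _ _ - _) (rip _ _ - _) => a b h1 h2 h3 h4.
  apply: (le_trans h2); have [h|h] := leP (b - a) 0; first by lra.
  rewrite -(ler_pM2r h); have := sqr_ge0 (a + b); nra.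
have [z zP] : exists l, forall e, 0 < e -> exists N, forall n, (N <= n)%N ->
  nrm (u n - l) <= e.
  apply: nrm_cvg => e e0.
  have e4 : 0 < e ^+ 2 * d / 4 by rewrite divr_gt0 ?mulr_gt0 ?exprn_gt0.
  have [N hN] := inv_small e4; exists N => i j Ni Nj.
  have ule k : (N <= k)%N -> J (u k) <= m + e ^+ 2 * d / 4.
    by move=> Nk; apply: (le_trans (uP k)); rewrite lerD2l hN.
  have := close _ _ _ e4 (ule _ Ni) (ule _ Nj).
  have -> : 4 * (e ^+ 2 * d / 4) = d * e ^+ 2 by field.
  by rewrite ler_pM2l // ler_sqr ?nnegrE ?nrm_ge0 // ltW.
exists z => h; apply/eqP; rewrite -subr_eq0 -normr_le0.
apply: (@le0_of_le_mul _ _ (K * nrm h + Num.sqrt (rip (A h) h))) =>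
  e /andP[e0 _].
have [N1 h1] := zP _ e0; have [N2 h2] := inv_small (exprn_gt0 2 e0).
pose n := maxn N1 N2.
have hn := h1 n (leq_maxl _ _); have hn2 := h2 n (leq_maxr _ _).
(* The residual of [u n] is small by [approx], the correction by boundedness of [A]. *)
have -> : rip (A z) h - f h = (rip (A (u n)) h - f h) - rip (A (u n - z)) h.
  by rewrite linB // ripBl; ring.
apply: (le_trans (ler_normB _ _)); rewrite addrC mulrDr lerD //.
  apply: (le_trans (rip_CS _ _)); rewrite mulrA ler_wpM2r ?nrm_ge0 //.
  by apply: (le_trans (AK _)); rewrite mulrC ler_wpM2r // ltW.
rewrite -ler_sqr ?nnegrE ?mulr_ge0 ?sqrtr_ge0 ?(ltW e0) // real_normK ?num_real
  //.
rewrite exprMn sqr_sqrtr //; apply: approx; apply: (le_trans (uP n)).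
by rewrite lerD2l.
Qed.

(** For the identity operator, [coercive_solve] is the Riesz representation theorem; it is applied
    to [h |-> Re <A h, y>]. The bound on [B] follows from [|B y|^2 = Re <A (B y), y>]. *)
Lemma adjoint_exists A : bounded_operator A -> exists B,
  bounded_operator B /\ forall x y, inner (A x) y = inner x (B y).
Proof.
move=> bA; have [K K0 AK] := bounded_operator_nrm bA; have [l _] := bA.
have ex y : exists z, forall h, rip z h = rip (A h) y.
  apply: (@coercive_solve id (fun h => rip (A h) y) 1 1 (K * nrm y)) => //.
  - by move=> x; rewrite mul1r.
  - by move=> x; rewrite mul1r ripxx.
  - by move=> u v; rewrite linD // ripDl.
  - by move=> t x; rewrite linZ // ripZl.
  - move=> x; apply: (le_trans (rip_CSW _ _)).
    by rewrite mulrAC ler_wpM2r ?nrm_ge0.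
have [B BP] := choice ex.
have AB x y : inner (A x) y = inner x (B y).
  by rewrite !inner_rip -(linZ _ _ l) -!BP !(ripC (B y)).
exists B; split=> //; apply: (@nrm_bounded_operator _ K).
  move=> a x y; apply: rip_eq => h; rewrite !(ripC _ h) /rip.
  by rewrite innerDr innerZr -!AB innerDr innerZr.
move=> y; have [->|y0] := eqVneq (B y) 0;
  first by rewrite nrm0 mulr_ge0 ?nrm_ge0 // ltW.
have n0 : 0 < nrm (B y) by rewrite lt_def nrm_eq0 y0 nrm_ge0.
rewrite -(ler_pM2r n0) -expr2 -ripxx BP; apply: (le_trans (rip_CSW _ _)).
by rewrite mulrAC ler_wpM2r ?nrm_ge0.
Qed.

Lemma adjointP A : bounded_operator A ->
  bounded_operator (adjoint A) /\ forall x y,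
    inner (A x) y = inner x (adjoint A y).
Proof.
by move=> /adjoint_exists h; have := xgetPex (cst 0) h.
Qed.

(** Surjectivity is [coercive_solve] for the functional [<y, .>]. Coercivity and Cauchy-Schwarz give
    [d |x| <= |A x|], hence injectivity and the bound [d^-1] on the inverse. *)
Lemma coercive_inverse A (K d : R) : linear A -> self_adjoint A ->
    0 < K -> (forall x, nrm (A x) <= K * nrm x) ->
    0 < d -> (forall x, d * nrm x ^+ 2 <= rip (A x) x) ->
  exists S, [/\ bounded_operator S, forall x, S (A x) = x & forall x,
    A (S x) = x].
Proof.
move=> l sA K0 AK d0 Ad.
have /choice[S SP] y : exists z, A z = y.
  have [|t x|x|z zP] := @coercive_solve A (rip y) K d (nrm y) l sA K0 AK d0 Ad.
  - by move=> x z; rewrite ripDr.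
  - by rewrite ripZr.
  - exact: rip_CSW.
  - by exists z; apply: rip_eq.
have Ab x : nrm x <= d^-1 * nrm (A x).
  have [->|x0] := eqVneq x 0;
    first by rewrite nrm0 mulr_ge0 ?nrm_ge0 // invr_ge0 ltW.
  have n0 : 0 < nrm x by rewrite lt_def nrm_eq0 x0 nrm_ge0.
  rewrite ler_pdivlMl // -(ler_pM2r n0) -mulrA -expr2.
  exact: le_trans (Ad x) (rip_CSW _ _).
have SA x : S (A x) = x.
  apply/eqP; rewrite -subr_eq0 -nrm_eq0 eq_le nrm_ge0 andbT.
  by rewrite (le_trans (Ab _)) // linB // SP subrr nrm0 mulr0.
exists S; split=> //; apply: (@nrm_bounded_operator _ d^-1).
  by move=> a x y; rewrite -{1}(SP x) -{1}(SP y) -l SA.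
by move=> x; rewrite -{2}(SP x).
Qed.

Lemma rip_scale1 (t : R) x : rip (t%:C *: x) x = t * nrm x ^+ 2.
Proof. by rewrite ripZl ripxx. Qed.

(** If [t < a], then [A - t] is coercive with constant [a - t], hence invertible. *)
Lemma spectrum_ge A (a t : R) : bounded_operator A -> self_adjoint A ->
  (forall x, a * nrm x ^+ 2 <= rip (A x) x) -> spectrum A t%:C -> a <= t.
Proof.
move=> bA sA Aa; apply: contraPT; rewrite -ltNge => ta.
have [l _] := bA; have [K K0 AK] := bounded_operator_nrm bA.
have [||||||S [bS S1 S2]] := @coercive_inverse (fun x =>
  A x - t%:C *: x) (K + `|t|) (a - t).
- exact: linear_sub_scale.
- by move=> x y; rewrite ripBl ripBr sA ripZl ripZr.
- by rewrite ltr_wpDr.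
- by move=> x; apply: (le_trans (nrmB _ _)); rewrite nrmZr mulrDl lerD2r.
- by rewrite subr_gt0.
- by move=> x; rewrite ripBl rip_scale1 mulrBl lerD2r.
by apply; exists S.
Qed.

(** If [b < t], then [t - A] is coercive; the inverse of [A - t] is minus the inverse [S] so
    obtained. *)
Lemma spectrum_le A (b t : R) : bounded_operator A -> self_adjoint A ->
  (forall x, rip (A x) x <= b * nrm x ^+ 2) -> spectrum A t%:C -> t <= b.
Proof.
move=> bA sA Ab; apply: contraPT; rewrite -ltNge => tb.
have [l _] := bA; have [K K0 AK] := bounded_operator_nrm bA.
have [||||||S [bS S1 S2]] := @coercive_inverse (fun x =>
  - (A x - t%:C *: x)) (K + `|t|) (t - b).
- by move=> c x y; rewrite linear_sub_scale // opprD scalerN.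
- by move=> x y; rewrite ripNl ripNr ripBl ripBr sA ripZl ripZr.
- by rewrite ltr_wpDr.
- by move=> x; rewrite nrmN; apply: (le_trans (nrmB _ _));
  rewrite nrmZr mulrDl lerD2r.
- by rewrite subr_gt0.
- move=> x; rewrite ripNl ripBl rip_scale1; have := Ab x; lra.
apply; exists (fun x => - S x); have [lS [M SM]] := bS; split.
- split; first by move=> c x y; rewrite lS opprD scalerN.
  by exists M => x; rewrite normrN.
- by move=> x; rewrite -(linN _ lS).
- by move=> x; rewrite (linN _ l) scalerN -opprD S2.
Qed.

End linear_operators.

(** * Polynomials of a self-adjoint operator *)

Section polynomials_of_operators.
Context {R : realType} {H : hilbertType R}.
Implicit Types (x y z : H) (A B : H -> H) (p q : {poly R}) (P Q : {poly R[i]}).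

(** Complex coefficients allow a real polynomial to be split into linear factors. *)
Definition complex_poly_op Q A x := \sum_(i < size Q) Q`_i *: iter i A x.

Lemma complex_poly_opE n Q A x : (size Q <= n)%N ->
  complex_poly_op Q A x = \sum_(i < n) Q`_i *: iter i A x.
Proof.
move=> sn; rewrite /complex_poly_op
  (big_ord_widen n (fun i => Q`_i *: iter i A x)) //.
rewrite big_mkcond; apply: eq_bigr => i _; case: ltnP => // h.
by rewrite nth_default // scale0r.
Qed.

Lemma complex_poly_opD P Q A x :
  complex_poly_op (P + Q) A x = complex_poly_op P A x + complex_poly_op Q A x.
Proof.
pose n := maxn (size P) (size Q).
rewrite !(@complex_poly_opE n) ?leq_maxl ?leq_maxr ?size_polyD // -big_split /=.
by apply: eq_bigr => i _; rewrite coefD scalerDl.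
Qed.

Lemma complex_poly_opZ a Q A x :
  complex_poly_op (a *: Q) A x = a *: complex_poly_op Q A x.
Proof.
rewrite !(@complex_poly_opE (size Q)) ?size_scale_leq // scaler_sumr.
by apply: eq_bigr => i _; rewrite coefZ scalerA.
Qed.

Lemma complex_poly_opC a A x : complex_poly_op a%:P A x = a *: x.
Proof. by rewrite (@complex_poly_opE 1) ?size_polyC_leq1 // big_ord1 coefC. Qed.

Lemma complex_poly_opMX Q A x :
  complex_poly_op (Q * 'X) A x = complex_poly_op Q A (A x).
Proof.
rewrite (@complex_poly_opE (size Q).+1) ?size_polyMXn_leq; last first.
  by rewrite (leq_trans (size_polyMleq _ _)) // size_polyX addn2.
rewrite big_ord_recl coefMX /= scale0r add0r.
by apply: eq_bigr => i _; rewrite coefMX -iterSr.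
Qed.

Lemma complex_poly_opX A x : complex_poly_op 'X A x = A x.
Proof. by rewrite -(mul1r 'X) complex_poly_opMX complex_poly_opC scale1r. Qed.

Lemma complex_poly_op_comm Q A x : linear A ->
  A (complex_poly_op Q A x) = complex_poly_op Q A (A x).
Proof.
move=> l; rewrite /complex_poly_op
  (big_morph A (fun u v => linD u v l) (lin0 l)).
by apply: eq_bigr => i _; rewrite linZ // -iterS iterSr.
Qed.

Lemma complex_poly_opM P Q A x : linear A ->
  complex_poly_op (P * Q) A x = complex_poly_op P A (complex_poly_op Q A x).
Proof.
move=> l; elim/poly_ind: P x => [|P c IH] x.
  by rewrite mul0r -polyC0 !complex_poly_opC !scale0r.
rewrite mulrDl complex_poly_opD -mulrA (mulrC 'X) mulrA complex_poly_opMX IH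
  mul_polyC complex_poly_opZ.
by rewrite complex_poly_opD complex_poly_opMX complex_poly_opC
  complex_poly_op_comm.
Qed.

Lemma poly_opE q A x :
  poly_op q A x = complex_poly_op (map_poly (real_complex R) q) A x.
Proof.
rewrite /poly_op /complex_poly_op size_map_poly.
by apply: eq_bigr => i _; rewrite coef_map.
Qed.

Lemma poly_opD p q A x : poly_op (p + q) A x = poly_op p A x + poly_op q A x.
Proof. by rewrite !poly_opE rmorphD complex_poly_opD. Qed.

Lemma poly_opC (c : R) A x : poly_op c%:P A x = c%:C *: x.
Proof. by rewrite poly_opE map_polyC complex_poly_opC. Qed.

Lemma poly_opM p q A x : linear A ->
  poly_op (p * q) A x = poly_op p A (poly_op q A x).
Proof. by move=> l; rewrite !poly_opE rmorphM complex_poly_opM. Qed.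

Lemma poly_opN q A x : linear A -> poly_op (- q) A x = - poly_op q A x.
Proof.
by move=> l; rewrite -mulN1r -polyCN poly_opM // poly_opC rmorphN scaleN1r.
Qed.

Lemma poly_opX A x : poly_op 'X A x = A x.
Proof. by rewrite poly_opE map_polyX complex_poly_opX. Qed.

Lemma poly_op_comm q A x : linear A -> A (poly_op q A x) = poly_op q A (A x).
Proof. by move=> l; rewrite !poly_opE complex_poly_op_comm. Qed.

Lemma poly_opMXC q (c : R) A x :
  poly_op (q * 'X + c%:P) A x = poly_op q A (A x) + c%:C *: x.
Proof.
by rewrite poly_opD poly_opC !poly_opE rmorphM /= map_polyX complex_poly_opMX.
Qed.

Lemma poly_op_bounded q A : bounded_operator A ->
  bounded_operator (poly_op q A).
Proof.
move=> bA; have [l _] := bA; have [K K0 AK] := bounded_operator_nrm bA.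
elim/poly_ind: q => [|q c [lq bq]].
  by apply: (@nrm_bounded_operator _ _ _ 0) => [a x y|x];
    rewrite -polyC0 !poly_opC !scale0r ?scaler0 ?addr0 ?nrm0 ?mul0r.
have [M M0 qM] := bounded_operator_nrm (conj lq bq).
apply: (@nrm_bounded_operator _ _ _ (M * K + `|c|)) => [a x y|x].
  rewrite !poly_opMXC l lq !scalerDr !scalerA addrACA mulrC; congr (_ + _).
rewrite poly_opMXC (le_trans (nrmD _ _)) // nrmZr mulrDl lerD2r.
by rewrite (le_trans (qM _)) // -mulrA ler_wpM2l // ltW.
Qed.

Lemma poly_op_self_adjoint q A : linear A -> self_adjoint A ->
  self_adjoint (poly_op q A).
Proof.
move=> l sA; elim/poly_ind: q => [|q c IH] x y.
  by rewrite -polyC0 !poly_opC !ripZl ripZr.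
by rewrite !poly_opMXC ripDl ripDr ripZl ripZr IH sA poly_op_comm.
Qed.

Definition bounded_below A :=
  exists2 d : R, 0 < d & forall x, d * nrm x <= nrm (A x).

(** [Q(A)] is a nonzero scalar times a composition of operators [A - w] with [w] a root of [Q], and
    lower bounds multiply under composition. *)
Lemma complex_poly_op_bounded_below Q A : linear A -> Q != 0 ->
  (forall w, root Q w -> bounded_below (fun x => A x - w *: x)) ->
  bounded_below (complex_poly_op Q A).
Proof.
move=> l Q0; have [r Qr] := closed_field_poly_normal Q; rewrite Qr => Qb.
have {}Qb w : w \in r -> bounded_below (fun x => A x - w *: x).
  by move=> wr; apply: Qb; rewrite rootZ ?lead_coef_eq0 // root_prod_XsubC.
have [d d0 dP] : bounded_below (complex_poly_op (\prod_(w <- r) ('X - w%:P)) A).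
  elim: r Qb {Qr} => [|w r IH] Qb.
    by exists 1 => // x; rewrite big_nil complex_poly_opC scale1r mul1r.
  have [d d0 dP] := IH (fun v vr => Qb v (mem_behead (s := w :: r) vr)).
  have [d' d'0 dP'] := Qb w (mem_head _ _).
  exists (d' * d) => [|x]; first exact: mulr_gt0.
  rewrite big_cons complex_poly_opM // complex_poly_opD -polyCN
    complex_poly_opC complex_poly_opX.
  rewrite scaleNr; apply: (le_trans _ (dP' _)).
  by rewrite -mulrA ler_wpM2l // ltW.
have c0 : 0 < complex.Re `|lead_coef Q|.
  have : 0 < `|lead_coef Q| by rewrite normr_gt0 lead_coef_eq0.
  by rewrite ltcE => /andP[].
exists (complex.Re `|lead_coef Q| * d) => [|x]; first exact: mulr_gt0.
by rewrite complex_poly_opZ nrmZ -mulrA ler_wpM2l // ltW.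
Qed.

(** By [self_adjoint_ir], pairing [(A - w) x] with [i x] leaves only [Im w * |x|^2] up to sign, so
    [A - w] is bounded below unless [w] is real. An inverse bounded by [K] would give the lower
    bound [K^-1]. *)
Lemma not_bounded_below_spectrum A w : bounded_operator A -> self_adjoint A ->
  ~ bounded_below (fun x => A x - w *: x) ->
  exists2 t : R, w = t%:C & spectrum A t%:C.
Proof.
move=> bA sA nb; have [l _] := bA.
have w0 : complex.Im w = 0.
  apply/eqP; apply: contra_notT nb => b0; exists `|complex.Im w|;
    first by rewrite normr_gt0.
  move=> x; have [->|x0] := eqVneq x 0; first by rewrite nrm0 mulr0 nrm_ge0.
  have n0 : 0 < nrm x by rewrite lt_def nrm_eq0 x0 nrm_ge0.
  rewrite -(ler_pM2r n0) -[X in _ <= _ * X]nrmZi.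
  apply: le_trans (rip_CS _ _).
  rewrite ripBl self_adjoint_ir // sub0r normrN /rip innerZl innerZr innerxx.
  case: {b0} w => a b /=.
  have -> : a * (0 * nrm x ^+ 2 - -1 * 0) - b * (0 * 0 + -1 * nrm x ^+ 2)
    = b * nrm x ^+ 2 by ring.
  by rewrite normrM (ger0_norm (sqr_ge0 _)) expr2 mulrA.
have wE : w = (complex.Re w)%:C by case: w w0 {nb} => a b /= ->.
exists (complex.Re w) => //; rewrite -wE => -[S [bS SA _]]; apply: nb.
have [K K0 SK] := bounded_operator_nrm bS.
exists K^-1 => [|x]; first by rewrite invr_gt0.
by rewrite ler_pdivrMl // -{1}(SA x).
Qed.

(* Expand [0 <= <A y, y>] at [y = x - A x / K]. *)
Lemma nonneg_nrm_sqr_le A (K : R) : linear A -> self_adjoint A ->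
  (forall x, 0 <= rip (A x) x) -> 0 < K -> (forall x, nrm (A x) <= K * nrm x) ->
  forall x, nrm (A x) ^+ 2 <= K * rip (A x) x.
Proof.
move=> l sA A0 K0 AK x; have := A0 (x - K^-1%:C *: A x).
rewrite linB // linZ // !ripBl !ripBr !ripZl !ripZr (sA (A x) x) ripxx.
have := le_trans (rip_CSW (A (A x)) (A x)) (ler_wpM2r (nrm_ge0 _) (AK (A x))).
rewrite -mulrA -expr2.
move: (rip (A x) x) (rip (A (A x)) (A x)) (nrm (A x) ^+ 2) => a b c h1 h2.
have -> : c = K * (K^-1 * c) by rewrite mulrA mulfV ?mul1r // gt_eqF.
rewrite ler_pM2l //; have : K^-1 * (K^-1 * b) <= K^-1 * c.
  by rewrite ler_pM2l ?invr_gt0 // ler_pdivrMl.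
by move: h2; lra.
Qed.

(* The witness is the infimum of the numerical range. *)
Lemma numerical_range_inf A : bounded_operator A -> self_adjoint A ->
  (exists x : H, x != 0) ->
  exists2 m : R, forall x, m * nrm x ^+ 2 <= rip (A x) x &
    ~ bounded_below (fun x => A x - m%:C *: x).
Proof.
move=> bA sA [x0 x00]; have [l _] := bA;
  have [K K0 AK] := bounded_operator_nrm bA.
pose E := [set rip (A x) x | x in [set x | nrm x = 1]].
have unit_scale x : x != 0 -> nrm ((nrm x)^-1%:C *: x) = 1.
  move=> xn; rewrite nrmZr ger0_norm ?invr_ge0 ?nrm_ge0 // mulVf //.
  by rewrite nrm_eq0.
have Elb : lbound E (- K).
  move=> _ [x /= x1 <-]; have := rip_CS (A x) x; rewrite x1 mulr1.
  move=> /le_trans /(_ (AK x)); by rewrite x1 mulr1 ler_norml => /andP[].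
have infE : has_inf E.
  split; last by exists (- K).
  by exists (rip (A ((nrm x0)^-1%:C *: x0)) ((nrm x0)^-1%:C *:
    x0)), ((nrm x0)^-1%:C *: x0); rewrite //= unit_scale.
pose m := inf E; pose W x := A x - m%:C *: x.
have mP x : m * nrm x ^+ 2 <= rip (A x) x.
  have [->|xn] := eqVneq x 0; first by rewrite nrm0 expr0n mulr0 lin0 // rip0l.
  have : m <= rip (A ((nrm x)^-1%:C *: x)) ((nrm x)^-1%:C *: x).
    by apply: ge_inf; [exists (- K) | exists ((nrm x)^-1%:C *: x);
      rewrite //= unit_scale].
  rewrite linZ // ripZl ripZr mulrA -expr2 exprVn ler_pdivlMl 1?mulrC //.
  by rewrite exprn_gt0 // lt_def nrm_eq0 xn nrm_ge0.
exists m => // -[d d0 dP].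
have lW : linear W := linear_sub_scale m%:C l.
have W0 x : 0 <= rip (W x) x by rewrite /W ripBl rip_scale1 subr_ge0.
have sW x y : rip (W x) y = rip x (W y).
  by rewrite /W ripBl ripBr sA ripZl ripZr.
pose K' := K + `|m|.
have WK x : nrm (W x) <= K' * nrm x.
  by apply: (le_trans (nrmB _ _)); rewrite nrmZr mulrDl lerD2r.
have K'0 : 0 < K' by rewrite ltr_wpDr.
have Wsq := nonneg_nrm_sqr_le lW sW W0 K'0 WK.
(* If [W = A - m] were bounded below by [d], then [d^2 <= |W x|^2 <= K' <W x, x>] on the unit
   sphere, so the numerical range would stay above [m + d^2 / K']. *)
have : m + d ^+ 2 / K' <= m.
  apply: lb_le_inf; first by case: infE.
  move=> _ [x /= x1 <-]; have := W0 x; have := Wsq x; have := dP x.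
  rewrite -/(W x) x1 mulr1 => h1 h2 _.
  have : rip (W x) x = rip (A x) x - m by rewrite /W ripBl rip_scale1 x1 expr1n
    mulr1.
  have : d ^+ 2 / K' <= rip (W x) x.
    rewrite ler_pdivrMr // mulrC; apply: le_trans h2.
    by rewrite ler_sqr ?nnegrE ?nrm_ge0 // ltW.
  by lra.
by rewrite gerDl leNgt divr_gt0 // exprn_gt0.
Qed.

Lemma poly_op_ge0 A q : bounded_operator A -> self_adjoint A ->
  (forall t : R, spectrum A t%:C -> 0 <= q.[t]) ->
    forall x, 0 <= rip (poly_op q A x) x.
Proof.
move=> bA sA q0 x; rewrite leNgt; apply/negP => x0; have [l _] := bA.
have Hx : exists x : H, x != 0.
  by exists x; apply: contraTneq x0 => ->; rewrite ripC rip0l ltxx.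
have bq := poly_op_bounded q bA; have sq := poly_op_self_adjoint q l sA.
have [m mP nm] := numerical_range_inf bq sq Hx.
have m0 : m < 0.
  rewrite ltNge; apply/negP => m0; move: x0; rewrite ltNge => /negP; apply.
  by apply: le_trans (mP x); rewrite mulr_ge0 ?sqr_ge0.
suff [t tA qt] : exists2 t : R, spectrum A t%:C & q.[t] = m.
  by have := q0 t tA; rewrite qt leNgt m0.
(* When [q - m] is the zero polynomial there is nothing to factor; any point of the spectrum will
   do, and [numerical_range_inf] for [A] itself provides one. *)
have [qm|qm] := eqVneq q m%:P.
  have [m' _ nm'] := numerical_range_inf bA sA Hx.
  have [t _ tA] := not_bounded_below_spectrum bA sA nm'.
  by exists t => //; rewrite qm hornerC.
pose Q := map_poly (real_complex R) (q - m%:P).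
have : exists2 w, root Q w & ~ bounded_below (fun x => A x - w *: x).
  apply: contra_notP nm => h.
  have [|w Qw|d d0 dP] := @complex_poly_op_bounded_below Q A l.
  - by rewrite map_poly_eq0 subr_eq0.
  - by apply: contrapT => nw; apply: h; exists w.
  exists d => // y; have := dP y.
  by rewrite -poly_opE poly_opD -polyCN poly_opC rmorphN scaleNr.
move=> [w Qw /(not_bounded_below_spectrum bA sA)[t wt tA]]; exists t => //.
move: Qw; rewrite wt fmorph_root /root hornerD hornerN hornerC subr_eq0.
by move=> /eqP.
Qed.

(** The polynomial [e^2 - q^2] is nonnegative on the spectrum, and its operator has quadratic form
    [e^2 |x|^2 - |q(A) x|^2]. *)
Lemma poly_op_le A q (e : R) : bounded_operator A -> self_adjoint A -> 0 <= e ->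
  (forall t : R, spectrum A t%:C -> `|q.[t]| <= e) ->
  forall x, nrm (poly_op q A x) <= e * nrm x.
Proof.
move=> bA sA e0 qe x; have [l _] := bA.
have := @poly_op_ge0 A ((e ^+ 2)%:P - q * q) bA sA.
have h (t : R) : spectrum A t%:C -> 0 <= ((e ^+ 2)%:P - q * q).[t].
  move=> tA; rewrite hornerD hornerN hornerM hornerC subr_ge0 -expr2.
  by rewrite -(real_normK (num_real _)) ler_sqr ?nnegrE // qe.
move=> /(_ h x); rewrite poly_opD poly_opN // poly_opM // poly_opC ripBl.
rewrite rip_scale1 (poly_op_self_adjoint q l sA) ripxx subr_ge0 -exprMn.
by rewrite ler_sqr ?nnegrE ?mulr_ge0 ?nrm_ge0.
Qed.

End polynomials_of_operators.

(** * Polynomial approximation *)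

Section approximation.
Context {R : realType}.
Implicit Types (f : R -> R) (x y e M : R).

(* Bernstein polynomials by conditioning on the first of [n] trials. *)
Fixpoint bernstein (n : nat) (g : nat -> R) : {poly R} :=
  if n is n'.+1 then 'X * bernstein n' (g \o S) + (1 - 'X) * bernstein n' g
  else (g 0%N)%:P.

Lemma bernsteinS n g x : (bernstein n.+1 g).[x] =
  x * (bernstein n (g \o S)).[x] + (1 - x) * (bernstein n g).[x].
Proof. by rewrite /= !hornerE. Qed.

Lemma bernstein_le n g h x : 0 <= x <= 1 ->
  (forall k, (k <= n)%N -> g k <= h k) ->
  (bernstein n g).[x] <= (bernstein n h).[x].
Proof.
move=> /andP[x0 x1]; elim: n g h => [|n IH] g h gh.
  by rewrite !hornerC gh.
rewrite !bernsteinS; apply: lerD; apply: ler_wpM2l; rewrite ?subr_ge0 //;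
  apply: IH => k kn; apply: gh => //; exact: leqW.
Qed.

Lemma bernstein_affine n g (a b x : R) :
  (bernstein n (fun k => a + b * g k)).[x] = a + b * (bernstein n g).[x].
Proof.
elim: n g => [|n IH] g; first by rewrite !hornerC.
by rewrite !bernsteinS (IH (g \o S)) IH; ring.
Qed.

(** Variance plus squared bias for the binomial law. The centre [c] is arbitrary because a success
    in the first trial shifts it to [c - 1] in the induction. *)
Lemma bernstein_sqr n (c x : R) :
  (bernstein n (fun k => (k%:R - c) ^+ 2)).[x] =
  n%:R * x * (1 - x) + (n%:R * x - c) ^+ 2.
Proof.
elim: n c => [|n IH] c; first by rewrite hornerC; ring.
rewrite bernsteinS IH.
rewrite (_ : _ \o S = fun k => (k%:R - (c - 1)) ^+ 2); last first.
  by apply/funext => k /=; rewrite -natr1; congr (_ ^+ 2); ring.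
by rewrite IH -natr1; ring.
Qed.

(* Uniform continuity on [0, M] in a form that suits Chebyshev's inequality. *)
Definition quadratic_modulus f M := forall e, 0 < e ->
  exists2 K, 0 <= K & forall x y, 0 <= x <= M -> 0 <= y <= M ->
    `|f x - f y| <= e + K * (x - y) ^+ 2.

(** Chebyshev's argument: averaging [|f (k / N) - f x| <= e / 2 + K (k / N - x)^2] over the binomial
    law costs [e / 2] plus [K] times the variance [x (1 - x) / N]. *)
Lemma bernstein_approx f : quadratic_modulus f 1 -> forall e, 0 < e ->
  exists q : {poly R}, forall x, 0 <= x <= 1 -> `|q.[x] - f x| <= e.
Proof.
move=> mf e e0; have e20 : 0 < e / 2 by rewrite divr_gt0.
have [K K0 fK] := mf _ e20.
have [N] : exists N : nat, K / N.+1%:R <= e / 2.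
  have K10 : 0 < e / 2 / (K + 1) by rewrite divr_gt0 // ltr_wpDl.
  have [N _ h] := near_infty_natSinv_lt (PosNum K10).
  exists N; have := ltW (h N (leqnn N)) => /=.
  rewrite ler_pdivlMr ?ltr_wpDl //; apply: le_trans.
  by rewrite mulrC ler_wpM2l ?invr_ge0 // lerDl.
move: N.+1 (ltn0Sn N) => {N} N N0 KN.
have NR0 : 0 < N%:R :> R by rewrite ltr0n.
exists (bernstein N (fun k => f (k%:R / N%:R))) => x x01.
have x1 : x * (1 - x) <= 1 by nra.
have bound k : (k <= N)%N ->
    `|f (k%:R / N%:R) - f x| <= e / 2 + K / N%:R ^+ 2 * (k%:R - N%:R * x) ^+ 2.
  move=> kN; have -> : K / N%:R ^+ 2 * (k%:R - N%:R * x) ^+ 2 = K * (k%:R /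
    N%:R - x) ^+ 2.
    by field; rewrite gt_eqF.
  by apply: fK; rewrite // divr_ge0 //= ler_pdivrMr // mul1r ler_nat.
have var : K / N%:R ^+ 2 * (bernstein N (fun k =>
  (k%:R - N%:R * x) ^+ 2)).[x] <= e / 2.
  rewrite bernstein_sqr subrr expr0n addr0.
  have -> : K / N%:R ^+ 2 * (N%:R * x * (1 - x)) = K / N%:R * (x * (1 - x)).
    by field; rewrite gt_eqF.
  by apply: le_trans KN; rewrite ler_piMr // divr_ge0.
rewrite ler_distl; apply/andP; split.
  have := @bernstein_le N (fun k =>
    (f x - e / 2) + (- (K / N%:R ^+ 2)) * (k%:R - N%:R * x) ^+ 2) (fun k =>
      f (k%:R / N%:R)) x x01.
  rewrite bernstein_affine => h.
  apply: (le_trans _ (h _)); first by rewrite mulNr; move: var; lra.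
  move=> k /bound; rewrite ler_distl => /andP[+ _].
  by rewrite mulNr opprD addrA.
have := @bernstein_le N (fun k => f (k%:R / N%:R)) (fun k =>
  (f x + e / 2) + K / N%:R ^+ 2 * (k%:R - N%:R * x) ^+ 2) x x01.
rewrite bernstein_affine => h.
apply: (le_trans (h _)); last by move: var; lra.
by move=> k /bound; rewrite ler_distl => /andP[_]; rewrite addrA.
Qed.

Lemma weierstrass f M : 0 < M -> quadratic_modulus f M -> forall e, 0 < e ->
  exists q : {poly R}, forall x, 0 <= x <= M -> `|q.[x] - f x| <= e.
Proof.
move=> M0 mf e e0.
have [|q qP] := @bernstein_approx (fun x => f (M * x)) _ e e0.
  move=> d d0; have [K K0 fK] := mf d d0; exists (K * M ^+ 2) => [|x y hx hy].
    by rewrite mulr_ge0 ?sqr_ge0.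
  rewrite -mulrA -exprMn mulrBr fK //; nra.
exists (q \Po (M^-1 *: 'X)) => x /andP[x0 xM].
rewrite horner_comp hornerZ hornerX -{2}(mulVKf (lt0r_neq0 M0) x).
by apply: qP; rewrite mulr_ge0 ?invr_ge0 ?(ltW M0) //= ler_pdivrMl // mulr1.
Qed.

(** Let [d] be the distance and [s] the sum of the two roots, so that [|x - y| = d s] and [d <= s].
    If [d > e], then [(x - y)^2 >= d^4 >= e^3 d], whence the constant [e ^- 3]. *)
Lemma sqrt_quadratic_modulus M : quadratic_modulus (@Num.sqrt R) M.
Proof.
move=> e e0; have ek : 0 <= e ^- 3 by rewrite invr_ge0 exprn_ge0 // ltW.
exists (e ^- 3) => // x y /andP[x0 _] /andP[y0 _].
have -> : (x - y) ^+ 2 = (Num.sqrt x - Num.sqrt y) ^+ 2 * (Num.sqrt x +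
  Num.sqrt y) ^+ 2.
  by rewrite -exprMn -subr_sqr !sqr_sqrtr.
move: (Num.sqrt x) (Num.sqrt y) (sqrtr_ge0 x) (sqrtr_ge0 y) => a b a0 b0.
rewrite -(real_normK (num_real (a - b))).
have : `|a - b| <= a + b by rewrite ler_norml; lra.
move: (a + b) `|a - b| (normr_ge0 (a - b)) => s d d0 ds {a b a0 b0}.
have [h|h] := leP d e.
  by rewrite (le_trans h) // lerDl mulr_ge0 // mulr_ge0 ?sqr_ge0.
apply: ler_wpDl; first exact: ltW.
rewrite mulrC ler_pdivlMr ?exprn_gt0 //.
have -> : d ^+ 2 * s ^+ 2 = d * (d * s ^+ 2) by ring.
rewrite ler_wpM2l // exprSr; apply: (@le_trans _ _ (d * d ^+ 2)).
  by rewrite mulrC ler_pM ?exprn_ge0 ?(ltW e0) ?(ltW h) // ler_sqr ?nnegrE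
    ?(ltW e0) ?(ltW h).
by rewrite ler_wpM2l // ler_sqr ?nnegrE // (le_trans d0).
Qed.

(** The graph of [u |-> u^a] lies above its tangent at [s]. For [a > 1] this is Young's inequality
    for [u] and [s^(a - 1)] with exponents [a] and [a / (a - 1)]. *)
Lemma powR_tangent (a u s : R) : 1 <= a -> 0 <= u -> 0 <= s ->
  a * u * s `^ (a - 1) <= u `^ a + (a - 1) * s `^ a.
Proof.
move=> a1 u0 s0; have [->|an1] := eqVneq a 1.
  by rewrite subrr mul0r addr0 powRr0 mulr1 mul1r powRr1.
have a1' : 0 < a - 1 by rewrite subr_gt0 lt_def an1.
have a0 : 0 < a by lra.
have := @conjugate_powR R u (s `^ (a - 1)) a (a / (a - 1)) u0 (powR_ge0 _ _) a0
  (divr_gt0 a0 a1').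
rewrite -powRrM (mulrC (a - 1)) divfK ?gt_eqF //.
have -> : a^-1 + (a / (a - 1))^-1 = 1 by field; rewrite !gt_eqF.
move=> /(_ erefl) h; rewrite -(ler_pM2l a0) in h; apply: le_trans.
  by rewrite -mulrA; exact: h.
by rewrite le_eqVlt; apply/orP; left; apply/eqP; field; rewrite !gt_eqF.
Qed.

(** The tangent inequality gives the Lipschitz constant [L = p M^(p - 1)], and
    [L d <= e + L^2 d^2 / (4 e)] by the square of [2 e - L d]. *)
Lemma powR_quadratic_modulus (p M : R) : 1 <= p ->
  quadratic_modulus (@powR R ^~ p) M.
Proof.
move=> p1 e e0; pose L := p * M `^ (p - 1).
have L0 : 0 <= L by rewrite mulr_ge0 ?powR_ge0 // (le_trans _ p1).
have lip x y : 0 <= y -> y <= x -> x <= M -> x `^ p - y `^ p <= L * (x - y).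
  move=> y0 yx xM; have x0 := le_trans y0 yx.
  have := powR_tangent p1 y0 x0.
  have E : x `^ p = x * x `^ (p - 1).
    by rewrite mulr_powRB1 // (lt_le_trans ltr01).
  have : x `^ (p - 1) <= M `^ (p - 1).
    by rewrite ge0_ler_powR ?nnegrE ?subr_ge0 // (le_trans x0).
  rewrite E /L => h1 h2.
  have : p * (x - y) * x `^ (p - 1) <= p * (x - y) * M `^ (p - 1).
    by rewrite ler_wpM2l // mulr_ge0 ?subr_ge0 //; lra.
  lra.
exists (L ^+ 2 / (4 * e)) => [|x y /andP[x0 xM] /andP[y0 yM]].
  by rewrite divr_ge0 ?sqr_ge0 // mulr_ge0 // ltW.
apply: (@le_trans _ _ (L * `|x - y|)).
  wlog yx : x y x0 y0 xM yM / y <= x.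
    move=> W; have [|/ltW] := leP y x; first exact: W.
    by rewrite distrC (distrC x); exact: W.
  rewrite !ger0_norm ?subr_ge0 //; first exact: lip.
  by rewrite ge0_ler_powR ?nnegrE //; lra.
rewrite -(real_normK (num_real (x - y))); move: `|x - y| => d.
rewrite -subr_ge0.
have -> : e + L ^+ 2 / (4 * e) * d ^+ 2 - L * d = (2 * e - L * d) ^+ 2 / (4 *
  e).
  by field; rewrite gt_eqF.
by rewrite divr_ge0 ?sqr_ge0 // mulr_ge0 // ltW.
Qed.

End approximation.

(** * Continuous functional calculus *)

Section functional_calculus.
Context {R : realType} {H : hilbertType R}.
Implicit Types (x y z : H) (A B : H -> H) (f : R -> R) (q g : {poly R}).

Definition spectrally_approximable A f := forall e, 0 < e ->
  exists q : {poly R}, forall t : R, spectrum A t%:C -> `|q.[t] - f t| <= e.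

(** By [poly_op_le], polynomials uniformly Cauchy on the spectrum give operators Cauchy in norm.
    Completeness yields a pointwise limit [B], and the uniform estimate makes it linear, bounded and
    a limit in norm. *)
Lemma is_cfc_exists A f : bounded_operator A -> self_adjoint A ->
  spectrally_approximable A f -> exists B, is_cfc A f B.
Proof.
move=> bA sA Af; have [l _] := bA.
have /choice[q qP] (n : nat) : exists q : {poly R}, forall t : R,
    spectrum A t%:C -> `|q.[t] - f t| <= n.+1%:R^-1.
  by apply: Af; rewrite invr_gt0.
have close (e : R) m n x : m.+1%:R^-1 <= e -> n.+1%:R^-1 <= e ->
    nrm (poly_op (q m) A x - poly_op (q n) A x) <= 2 * e * nrm x.
  move=> me ne; rewrite -poly_opN // -poly_opD.
  apply: poly_op_le => // [|t tA].
    by rewrite mulr_ge0 // (le_trans _ me).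
  rewrite hornerD hornerN; have := qP m t tA; have := qP n t tA.
  rewrite !ler_norml; move: m.+1%:R^-1 n.+1%:R^-1 me ne => u v me ne.
  by move=> /andP[? ?] /andP[? ?]; apply/andP; split; lra.
have /choice[B BP] x : exists y, forall e, 0 < e ->
    exists N, forall n, (N <= n)%N -> nrm (poly_op (q n) A x - y) <= e.
  apply: nrm_cvg => e e0.
  have e1 : 0 < e / (2 * (nrm x + 1)).
    by rewrite divr_gt0 // mulr_gt0 // ltr_wpDl // nrm_ge0.
  have [N NP] := inv_small e1; exists N => m n Nm Nn.
  apply: (le_trans (close _ m n x (NP _ Nm) (NP _ Nn))).
  have n1 : 0 < nrm x + 1 by rewrite ltr_wpDl // nrm_ge0.
  have -> : 2 * (e / (2 * (nrm x + 1))) * nrm x = e * (nrm x / (nrm x + 1)).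
    by field; rewrite gt_eqF.
  by rewrite ler_piMr ?(ltW e0) // ler_pdivrMr // mul1r lerDl.
(* The second index of [close] goes to infinity; taking [k >= n] makes [n.+1%:R^-1] dominate both
   errors. *)
have qB n x : nrm (poly_op (q n) A x - B x) <= 2 * n.+1%:R^-1 * nrm x.
  rewrite -subr_le0; apply: (@le0_of_le_mul _ _ 1) => e /andP[e0 _].
  have [N NP] := BP x _ e0; pose k := maxn N n.
  have h1 := NP k (leq_maxl _ _).
  have h2 : k.+1%:R^-1 <= n.+1%:R^-1 :> R.
    by rewrite lef_pV2 ?posrE // ler_nat ltnS leq_maxr.
  have := close _ n k x (lexx _) h2.
  rewrite mulr1 lerBlDr => h3.
  have -> : poly_op (q n) A x - B x = (poly_op (q n) A x - poly_op (q k) A x) +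
    (poly_op (q k) A x - B x).
    by rewrite addrA subrK.
  by apply: (le_trans (nrmD _ _)); rewrite [leRHS]addrC lerD.
have lB : linear B.
  move=> a x y; apply/eqP; rewrite -subr_eq0 -nrm_eq0 eq_le nrm_ge0 andbT.
  apply: (@le0_of_le_mul _ _ (complex.Re `|a| * (2 * nrm x) + 2 * nrm y + 2 *
    nrm (a *: x + y))).
  move=> e /andP[e0 _]; have [N NP] := inv_small e0.
  have [lq _] := poly_op_bounded (q N) bA.
  pose d v := poly_op (q N) A v - B v.
  have BE v : B v = poly_op (q N) A v - d v by rewrite /d subKr.
  have dP v : nrm (d v) <= e * (2 * nrm v).
    apply: (le_trans (qB N v)); rewrite mulrA (mulrC e) ler_wpM2r ?nrm_ge0 //.
    by rewrite ler_wpM2l // NP.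
  rewrite !BE lq scalerBr addrAC opprD addrACA !subKr.
  apply: (le_trans (nrmB _ _)); rewrite !mulrDr lerD //.
  apply: (le_trans (nrmD _ _)); rewrite nrmZ lerD // mulrCA ler_wpM2l //.
  by have := normr_ge0 a; rewrite lecE => /andP[].
have [K K0 qK] := bounded_operator_nrm (poly_op_bounded (q 0%N) bA).
exists B; split.
  apply: (@nrm_bounded_operator _ _ _ (2 + K)) => // x; have := qB 0%N x.
  rewrite invr1 mulr1 => h; rewrite -(subKr (poly_op (q 0%N) A x) (B x)).
  apply: (le_trans (nrmB _ _)); rewrite addrC mulrDl lerD //.
exists q => e e0; have e20 : 0 < e / 2 by rewrite divr_gt0.
have [N NP] := inv_small e20; exists N => // n /= Nn; have h := NP n Nn; split.
  by move=> t tA; apply: (le_trans (qP n t tA)); apply: (le_trans h); lra.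
move=> x; rewrite !nrmE -rmorphM lecR; apply: (le_trans (qB n x)).
by rewrite ler_wpM2r ?nrm_ge0 // mulrC -ler_pdivlMr.
Qed.

Lemma is_cfc_approx A f B (e : R) : is_cfc A f B -> 0 < e ->
  exists2 q : {poly R}, forall t : R, spectrum A t%:C -> `|q.[t] - f t| <= e &
    forall x, nrm (poly_op q A x - B x) <= e * nrm x.
Proof.
move=> [_ [q qP]] e0; have [N _ h] := qP e e0; have [h1 h2] := h N (leqnn N).
by exists (q N) => // x; have := h2 x; rewrite !nrmE -rmorphM lecR.
Qed.

Lemma is_cfc_self_adjoint A f B : bounded_operator A -> self_adjoint A ->
  is_cfc A f B -> self_adjoint B.
Proof.
move=> [l _] sA fB x y; apply/eqP; rewrite -subr_eq0 -normr_le0.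
apply: (@le0_of_le_mul _ _ (2 * (nrm x * nrm y))) => e /andP[e0 _].
have [q _ qB] := is_cfc_approx fB e0.
have sq := poly_op_self_adjoint q l sA.
have -> : rip (B x) y - rip x (B y) =
    rip x (poly_op q A y - B y) - rip (poly_op q A x - B x) y.
  by rewrite ripBl ripBr sq; ring.
apply: (le_trans (ler_normB _ _)).
have := rip_CS x (poly_op q A y - B y).
have := rip_CS (poly_op q A x - B x) y.
have := ler_wpM2l (nrm_ge0 x) (qB y); have := ler_wpM2r (nrm_ge0 y) (qB x).
lra.
Qed.

(** If [q] is within [e] of [f] on the spectrum, then [q - g + e >= 0] there and [poly_op_ge0]
    applies. One [e] is lost here and one in replacing [q(A)] by [B]. *)
Lemma is_cfc_ge A f B g : bounded_operator A -> self_adjoint A ->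
  is_cfc A f B ->
  (forall t : R, spectrum A t%:C -> g.[t] <= f t) ->
  forall x, rip (poly_op g A x) x <= rip (B x) x.
Proof.
move=> bA sA fB gf x; have [l _] := bA; rewrite -subr_le0.
apply: (@le0_of_le_mul _ _ (2 * nrm x ^+ 2)) => e /andP[e0 _].
have [q qf qB] := is_cfc_approx fB e0.
have := @poly_op_ge0 _ _ A (q - g + e%:P) bA sA.
have h (t : R) : spectrum A t%:C -> 0 <= (q - g + e%:P).[t].
  move=> tA; rewrite !hornerE; have := gf t tA; have := qf t tA.
  by rewrite ler_norml => /andP[]; lra.
move=> /(_ h x); rewrite !poly_opD poly_opN // poly_opC !ripDl ripNl rip_scale1.
have := rip_CSW (poly_op q A x - B x) x; have := ler_wpM2r (nrm_ge0 x) (qB x).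
by rewrite ripBl -mulrA -expr2; lra.
Qed.

(** If [q] is within [e] of the square root, then [t <= (|q| + e)^2 <= (1 + e) q^2 + e + e^2] on the
    spectrum, because [2 |q| <= q^2 + 1]. Passing to operators and letting [e] tend to 0 gives
    [A <= P^2]. *)
Lemma sqrt_cfc_sqr_ge A P : bounded_operator A -> self_adjoint A ->
  is_cfc A Num.sqrt P -> forall x, rip (A x) x <= nrm (P x) ^+ 2.
Proof.
move=> bA sA fP x; have [l _] := bA; rewrite -subr_le0.
set n := nrm x; set b := nrm (P x).
apply: (@le0_of_le_mul _ _ (3 * n ^+ 2 + 2 * b * n + (b + n) ^+ 2)).
move=> e /andP[e0 e1]; have [q qf qP] := is_cfc_approx fP e0.
have := @poly_op_ge0 _ _ A ((1 + e)%:P * (q * q) + (e + e ^+ 2)%:P - 'X) bA sA.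
have h (t : R) : spectrum A t%:C ->
    0 <= ((1 + e)%:P * (q * q) + (e + e ^+ 2)%:P - 'X).[t].
  move=> tA; rewrite !hornerD hornerN !hornerM !hornerC hornerX subr_ge0.
  have t1 : t <= Num.sqrt t ^+ 2.
    by have [t0|t0] := leP 0 t;
      [rewrite sqr_sqrtr | rewrite (le_trans (ltW t0)) ?sqr_ge0].
  apply: (le_trans t1).
  have := qf t tA; rewrite ler_norml => /andP[h1 h2].
  have := sqrtr_ge0 t; move: (Num.sqrt t) q.[t] h1 h2 => s r h1 h2 s0.
  have : s ^+ 2 <= (`|r| + e) ^+ 2.
    rewrite ler_sqr ?nnegrE ?addr_ge0 ?(ltW e0) //.
    by have := ler_norm r; lra.
  have rE := real_normK (num_real r).
  have : e * `|r| ^+ 2 = e * r ^+ 2 by rewrite rE.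
  have := mulr_ge0 (ltW e0) (sqr_ge0 (`|r| - 1)); move: `|r| rE => d rE.
  by lra.
move=> /(_ h x); rewrite !poly_opD poly_opN // !poly_opM // !poly_opC poly_opX.
rewrite !ripDl ripNl !rip_scale1 ripZl (poly_op_self_adjoint q l sA) ripxx -/n.
have qle : nrm (poly_op q A x) <= b + e * n.
  by rewrite -[poly_op q A x](subrK (P x)) addrC (le_trans (nrmD _ _)) //
    lerD2l.
have n0 : 0 <= n := nrm_ge0 _; have b0 : 0 <= b := nrm_ge0 _.
have en : e * n <= n by rewrite ler_piMl.
have en0 : 0 <= e * n by rewrite mulr_ge0 // ltW.
have q1 : nrm (poly_op q A x) ^+ 2 <= (b + e * n) ^+ 2.
  by rewrite ler_sqr ?nnegrE ?nrm_ge0 ?addr_ge0.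
have q2 : (b + e * n) ^+ 2 <= (b + n) ^+ 2.
  by rewrite ler_sqr ?nnegrE ?addr_ge0 // lerD2l.
have q3 : e ^+ 2 * n ^+ 2 <= e * n ^+ 2.
  by rewrite ler_wpM2r ?sqr_ge0 // expr2 ler_piMr // ltW.
have q4 : e * nrm (poly_op q A x) ^+ 2 <= e * (b + n) ^+ 2.
  by rewrite ler_wpM2l ?(ltW e0) // (le_trans q1).
by move: q1 q2 q3 q4; lra.
Qed.

End functional_calculus.

(** * Powers of the absolute value *)

Section powers_of_absolute_value.
Context {R : realType} {H : hilbertType R}.
Implicit Types (x y : H) (T : H -> H).

Lemma spectrally_approximable_ge0 (A : H -> H) (f : R -> R) :
  bounded_operator A -> self_adjoint A -> (forall x, 0 <= rip (A x) x) ->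
  (forall M, quadratic_modulus f M) -> spectrally_approximable A f.
Proof.
move=> bA sA A0 fm e e0; have [K K0 AK] := bounded_operator_nrm bA.
have [q qf] := weierstrass K0 (fm K) e0; exists q => t tA; apply: qf.
apply/andP; split.
  by apply: (spectrum_ge bA sA _ tA) => x; rewrite mul0r.
apply: (spectrum_le bA sA _ tA) => x; apply: (le_trans (rip_CSW _ _)).
by rewrite expr2 mulrA ler_wpM2r ?nrm_ge0.
Qed.

(** What the powers of [|T|] rely on. The last item is [<A x, x> <= |P x|^2] for
    [A = adjoint T \o T] and [P] its square root, since [<A x, x> = |T x|^2]. *)
Lemma op_abs_spec T : bounded_operator T ->
  [/\ bounded_operator (op_abs T), self_adjoint (op_abs T),
      forall x, 0 <= rip (op_abs T x) x &
      forall x, nrm (T x) ^+ 2 <= nrm (op_abs T x) ^+ 2].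
Proof.
move=> bT; have [bS TS] := adjointP bT; set A := adjoint T \o T.
have Arip x y : rip (A x) y = rip (T x) (T y).
  by rewrite /A /= ripC /rip -TS -!/(rip _ _) ripC.
have bA : bounded_operator A.
  have [K K0 TK] := bounded_operator_nrm bT;
    have [M M0 SM] := bounded_operator_nrm bS.
  have [[lT _] [lS _]] := (bT, bS).
  apply: (@nrm_bounded_operator _ _ _ (M * K)) => [a x y|x];
    first by rewrite /A /= lT lS.
  by rewrite (le_trans (SM _)) // -mulrA ler_wpM2l // ltW.
have sA : self_adjoint A by move=> x y; rewrite Arip ripC -Arip ripC.
have A0 x : 0 <= rip (A x) x by rewrite Arip ripxx sqr_ge0.
have := is_cfc_exists bA sA (spectrally_approximable_ge0 bA sA A0
  sqrt_quadratic_modulus).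
(* As a value of the calculus exists, [cfc] picks one instead of its default [cst 0]. *)
move=> /(xgetPex (cst 0)); rewrite -/(cfc A Num.sqrt) -/(op_abs T) => fP.
split; first by case: fP.
- exact: is_cfc_self_adjoint fP.
- move=> x; have := @is_cfc_ge _ _ _ _ _ 0 bA sA fP _ x.
  rewrite -polyC0 poly_opC scale0r rip0l; apply => t _.
  by rewrite hornerC sqrtr_ge0.
- by move=> x; rewrite -ripxx -Arip; exact: sqrt_cfc_sqr_ge.
Qed.

(* The tangent line of [u |-> u^(p/2)] at [u = m], with [u = |T|^2]. *)
Lemma op_powR_abs_tangent T (p m : R) : bounded_operator T -> 2 <= p ->
  0 <= m ->
  bounded_operator (op_powR (op_abs T) p) /\
  forall x, p / 2 * m `^ (p / 2 - 1) * nrm (T x) ^+ 2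
      + (1 - p / 2) * m `^ (p / 2) * nrm x ^+ 2
    <= rip (op_powR (op_abs T) p x) x.
Proof.
move=> bT p2 m0; have [bP sP P0 TP] := op_abs_spec bT; set P := op_abs T.
have p1 : 1 <= p by lra.
have := is_cfc_exists bP sP (spectrally_approximable_ge0 bP sP P0 (fun M =>
  @powR_quadratic_modulus R p M p1)).
move=> /(xgetPex (cst 0)); rewrite -/(cfc _ _) -/(op_powR _ _) => fB.
split; first by case: fB.
move=> x; have [lP _] := bP.
pose c := p / 2 * m `^ (p / 2 - 1); pose d := (1 - p / 2) * m `^ (p / 2).
have c0 : 0 <= c by rewrite mulr_ge0 ?powR_ge0 //; lra.
have := @is_cfc_ge _ _ _ _ _ (c%:P * ('X * 'X) + d%:P) bP sP fB _ x.
rewrite poly_opD !poly_opM // !poly_opC !poly_opX ripDl ripZl rip_scale1 sP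
  ripxx.
move=> h; apply: le_trans (h _).
  (* Since [c >= 0], the norm of [T x] may be replaced by the larger norm of [|T| x]. *)
  by rewrite lerD2r ler_wpM2l.
move=> t tP; rewrite !hornerD !hornerM !hornerC hornerX.
have t0 : 0 <= t by apply: (spectrum_ge bP sP _ tP) => y; rewrite mul0r.
have p21 : 1 <= p / 2 by lra.
have := powR_tangent p21 (sqr_ge0 t) m0.
have -> : (t ^+ 2) `^ (p / 2) = t `^ p.
  by rewrite -powR_mulrn // -powRrM mulrCA mulfV ?mulr1.
rewrite -expr2 /c /d; lra.
Qed.

(** Real and imaginary parts are bounded separately. The crude constant 2 suffices to bound the set
    of Berezin values above. *)
Lemma inner_le x y : complex.Re `|inner x y| <= 2 * (nrm x * nrm y).
Proof.
have := rip_CS x y; have := rip_CS ('i *: x) y;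
  rewrite nrmZi inner_rip normc_def /=.
move: (rip x y) (rip _ y) (nrm x * nrm y) => a b c hb ha.
have c0 : 0 <= c by apply: le_trans ha.
rewrite -ler_sqr ?nnegrE ?mulr_ge0 ?sqrtr_ge0 // sqr_sqrtr ?addr_ge0 ?sqr_ge0
  //.
have : a ^+ 2 <= c ^+ 2 by rewrite -(real_normK (num_real a)) ler_sqr ?nnegrE.
have : b ^+ 2 <= c ^+ 2 by rewrite -(real_normK (num_real b)) ler_sqr ?nnegrE.
have := sqr_ge0 c; lra.
Qed.

Lemma sqr_zero_bound T x : bounded_operator T -> (forall y, T (T y) = 0) ->
  nrm x = 1 ->
  4 * complex.Re `|inner (T x) x| ^+ 2 <= nrm (T x) ^+ 2 + nrm (adjoint T x) ^+
    2.
Proof.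
move=> bT T0 x1; have [bS TS] := adjointP bT; set c := inner (T x) x.
set r := complex.Re `|c|; set S := adjoint T.
have r0 : 0 <= r by have := normr_ge0 c; rewrite lecE => /andP[].
have orth : inner (T x) (S x) = 0.
  by rewrite -TS T0 -(scale0r 0) innerZl mul0r.
have nc : `|c^*| = `|c| by rewrite normcJ.
have cc : c * c^* = (r ^+ 2)%:C.
  by rewrite -sqr_normc -(RRe_real (normr_real c)) -rmorphXn.
(* The coefficients make both terms of [<u, x>] equal to [|c|^2], as [<S x, x>] is the conjugate of
   [c]. *)
pose u := c^* *: T x + c *: S x.
have ux : rip u x = 2 * r ^+ 2.
  rewrite /u ripDl /rip !innerZl -/c (innerC (S x)) -TS -/c (mulrC _ c) cc /=.
  by ring.
have uu : nrm u ^+ 2 = r ^+ 2 * (nrm (T x) ^+ 2 + nrm (S x) ^+ 2).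
  rewrite -ripxx /u ripDl !ripDr [X in _ + X + _]/rip [X in _ + (X + _)]/rip.
  rewrite !innerZl !innerZr orth (innerC (S x)) orth conjc0 !mulr0 /= addr0
    add0r.
  by rewrite !ripxx !nrmZ nc -/r; ring.
have := rip_CS u x; rewrite x1 mulr1 ux.
have := nrm_ge0 u => u0; rewrite ger0_norm ?mulr_ge0 ?sqr_ge0 // => h.
have : (2 * r ^+ 2) ^+ 2 <= nrm u ^+ 2 by rewrite ler_sqr ?nnegrE ?mulr_ge0
  ?sqr_ge0.
rewrite uu; have [->|rn] := eqVneq r 0.
  by move=> _; rewrite expr0n mulr0 addr_ge0 ?sqr_ge0.
have r20 : 0 < r ^+ 2 by rewrite exprn_gt0 // lt_def rn.
move=> h2; rewrite -(ler_pM2l r20); move: h2; lra.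
Qed.

Lemma sqr_zero_inner_powR T (p : R) x : bounded_operator T ->
  (forall y, T (T y) = 0) -> 2 <= p -> nrm x = 1 ->
  complex.Re `|inner (T x) x| `^ p <= (2 `^ (1 + p / 2))^-1 *
    rip (op_powR (op_abs T) p x + op_powR (op_abs (adjoint T)) p x) x.
Proof.
move=> bT T0 p2 x1; have [bS _] := adjointP bT.
have := sqr_zero_bound bT T0 x1; set r := complex.Re _.
have r0 : 0 <= r by have := normr_ge0 (inner (T x) x); rewrite lecE => /andP[].
set a := nrm (T x) ^+ 2; set b := nrm (adjoint T x) ^+ 2 => rab.
pose m := (a + b) / 2; have m0 : 0 <= m by rewrite divr_ge0 ?addr_ge0 ?sqr_ge0.
have p20 : 0 < p / 2 by rewrite divr_gt0 // (lt_le_trans _ p2).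
have mE := mulr_powRB1 m0 p20.
have m2 : r ^+ 2 * 2 <= m by rewrite /m; lra.
(* With the tangent taken at the mean [m] of [a] and [b], the linear terms of the two tangent bounds
   cancel. *)
have balance M : p / 2 * M * a + (1 - p / 2) * (m * M) +
    (p / 2 * M * b + (1 - p / 2) * (m * M)) = 2 * (m * M) by rewrite /m; field.
have [_ /(_ x) ha] := op_powR_abs_tangent bT p2 m0.
have [_ /(_ x) hb] := op_powR_abs_tangent bS p2 m0.
rewrite x1 expr1n !mulr1 -/a -/b in ha hb.
have sum : 2 * m `^ (p / 2) <= rip (op_powR (op_abs T) p x
    + op_powR (op_abs (adjoint T)) p x) x.
  rewrite ripDl; apply: le_trans (lerD ha hb).
  by rewrite -mE balance.
have -> : r `^ p = (r ^+ 2) `^ (p / 2).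
  by rewrite -powR_mulrn // -powRrM mulrCA mulfV ?mulr1.
rewrite ler_pdivlMl ?powR_gt0 //; apply: le_trans sum.
(* Split [2^(1 + p/2)] as [2 * 2^(p/2)]; what remains is [(2 r^2)^(p/2) <= m^(p/2)]. *)
rewrite powRD ?powRr1 //; last by rewrite pnatr_eq0 implybT.
rewrite -mulrA ler_pM2l // -powRM ?sqr_ge0 //.
apply: ge0_ler_powR; rewrite ?nnegrE ?(ltW p20) ?m0 ?mulr_ge0 ?sqr_ge0 //.
by rewrite mulrC.
Qed.

End powers_of_absolute_value.

(* Passage from unit vectors to the Berezin radius *)
Local Close Scope complex_scope.
Unset Implicit Arguments.

Theorem corollary2p29 (R : realType) (Omega : Type) (H : rkhs R Omega)
    (Omega_neq0 : [set: Omega] !=set0)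
    (kernel_neq0 : forall lam : Omega, rkernel H lam != 0)
    (T : H -> H) (T_bounded : bounded_operator T)
    (T_sqr0 : forall x, T (T x) = 0)
    (p : R) (p_ge2 : 2 <= p) :
  ber T `^ p <=
  (2 `^ (1 + p / 2))^-1 *
  ber (fun x => op_powR (op_abs T) p x + op_powR (op_abs (adjoint T)) p x).
Proof.
set B := fun x => _ + _; set C := _ * ber B.
pose k lam := normalized_rkernel H lam.
have p0 : 0 < p by lra.
have unit lam : nrm (k lam) = 1.
  rewrite /k /normalized_rkernel nrmE -fmorphV nrmZr ger0_norm ?invr_ge0
    ?nrm_ge0 //.
  by rewrite mulVf // nrm_eq0.
have absge0 (c : R[i]) : 0 <= complex.Re `|c|.
  by have := normr_ge0 c; rewrite lecE => /andP[].
have ReJ (c : R[i]) : complex.Re c <= complex.Re `|c|.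
  have := normc_ge_Re c; rewrite lecE => /andP[_] /=; apply: le_trans.
  exact: ler_norm.
(* Only boundedness of the two powers is extracted, so the tangent point 0 is arbitrary. *)
have [bB1 _] := op_powR_abs_tangent T_bounded p_ge2 (lexx 0).
have [bB2 _] := op_powR_abs_tangent (adjointP T_bounded).1 p_ge2 (lexx 0).
have [K1 _ hK1] := bounded_operator_nrm bB1.
have [K2 _ hK2] := bounded_operator_nrm bB2.
(* A real [sup] dominates its members only for a set bounded above, hence the explicit bound. *)
have berB lam : complex.Re `|inner (B (k lam)) (k lam)| <= ber B.
  apply: ub_le_sup; last by exists lam.
  exists (2 * (K1 + K2)) => _ [mu _ <-]; apply: (le_trans (inner_le _ _)).
  rewrite ler_pM2l // unit mulr1; apply: (le_trans (nrmD _ _)).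
  apply: lerD; [apply: le_trans (hK1 _) _ | apply: le_trans (hK2 _) _];
    by rewrite unit mulr1.
have le_C lam : complex.Re `|inner (T (k lam)) (k lam)| `^ p <= C.
  apply: (le_trans (sqr_zero_inner_powR T_bounded T_sqr0 p_ge2 (unit lam))).
  rewrite ler_wpM2l ?invr_ge0 ?powR_ge0 //.
  exact: le_trans (ReJ _) (berB lam).
have [lam0 _] := Omega_neq0.
have C0 : 0 <= C := le_trans (powR_ge0 _ _) (le_C lam0).
(* [ber T] is a supremum of values, not of their powers, so the [p]-th root is taken pointwise
   first. *)
have ub lam : complex.Re `|inner (T (k lam)) (k lam)| <= C `^ p^-1.
  have := absge0 (inner (T (k lam)) (k lam)).
  have := le_C lam; move: (complex.Re _) => r rC r0.
  rewrite -(powRr1 r0) -(mulfV (lt0r_neq0 p0)) powRrM.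
  by rewrite ge0_ler_powR ?nnegrE ?powR_ge0 // invr_ge0 ltW.
have ber_le : ber T <= C `^ p^-1.
  apply: ge_sup => [|_ [lam _ <-]]; last exact: ub.
  by exists (complex.Re `|inner (T (k lam0)) (k lam0)|), lam0.
have ber_ge0 : 0 <= ber T.
  apply: le_trans (absge0 _) _; last apply: ub_le_sup; last by exists lam0.
  by exists (C `^ p^-1) => _ [lam _ <-]; exact: ub.
rewrite -[leRHS](powRr1 C0) -(mulVf (lt0r_neq0 p0)) powRrM.
by rewrite ge0_ler_powR ?nnegrE ?powR_ge0 // ltW.
Qed.
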